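(* Let $\phi_1=x^2+c_1$ and $\phi_2=x^2+c_2$ for some distinct integers $c_1,c_2\in\mathbb{Z}$. Assume that the following conditions hold: (1) Both $\phi_1$ and $\phi_2$ have periodic points that are rational squares (i.e. each of $\mathrm{Per}(\phi_1,\mathbb{Q})$ and $\mathrm{Per}(\phi_2,\mathbb{Q})$ contains the square of a rational number). (2) Both $\phi_1(\mathbb{Z})\cap\mathrm{PrePer}(\phi_2,\mathbb{Q})$ and $\phi_2(\mathbb{Z})\cap\mathrm{PrePer}(\phi_1,\mathbb{Q})$ are non-empty. Then, up to reordering $c_1$ and $c_2$, either $$(c_1,c_2)=(-1,-3)\quad\text{or}\quad (c_1,c_2)=(s^2-s^4,\,-1-s^2-s^4)\ \text{ for some } s\in\mathbb{Z}.$$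
   Context: For a polynomial $\phi\in\mathbb{Q}[x]$, $\phi^n$ denotes the $n$-fold iterate of $\phi$ under composition. $\mathrm{Per}(\phi,\mathbb{Q})$ is the set of all $P\in\mathbb{Q}$ such that $\phi^n(P)=P$ for some $n\geq1$. $\mathrm{PrePer}(\phi,\mathbb{Q})$ is the set of all $P\in\mathbb{Q}$ such that $\phi^n(P)\in\mathrm{Per}(\phi,\mathbb{Q})$ for some $n\geq1$. $\phi(\mathbb{Z})=\{\phi(b):b\in\mathbb{Z}\}$. *)

(* Defs.v *)
From mathcomp Require Import all_boot all_order all_algebra.
From mathcomp Require Import classical_sets.

Set Implicit Arguments.
Unset Strict Implicit.
Unset Printing Implicit Defensive.

Import GRing.Theory.
Local Open Scope ring_scope.
Local Open Scope classical_set_scope.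

Definition iter_poly (phi : {poly rat}) (n : nat) : {poly rat} :=
  iter n (fun q => phi \Po q) 'X.

Definition Per (phi : {poly rat}) : set rat :=
  [set P | exists n : nat, (1 <= n)%N /\ (iter_poly phi n).[P] = P].

Definition PrePer (phi : {poly rat}) : set rat :=
  [set P | exists n : nat, (1 <= n)%N /\ Per phi (iter_poly phi n).[P]].

Definition int_image (phi : {poly rat}) : set rat :=
  [set phi.[b%:~R] | b in [set: int]].

Definition quad (c : int) : {poly rat} := 'X^2 + (c%:~R)%:P.

Definition rational_squares : set rat := [set r ^+ 2 | r in [set: rat]].

(* Main.v *)
Require Import Defs.
From mathcomp Require Import all_boot all_order all_algebra.
From mathcomp Require Import classical_sets.
From mathcomp Require Import ring zify.

(** The argument combines three elementary facts about x^2 + c with c an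
    integer.

    Denominators are squared by x^2 + c ([denq_sqr_add_int]), so a rational
    periodic point is an integer, and if it is the square of a rational, it is
    the square of an integer s >= 0.  Integer cycles have length at most 2
    ([int_cycle_length_le2]): the successive differences along an orbit divide
    each other in turn, hence agree up to sign along a cycle.  So s^2 is either
    a fixed point, c = s^2 - s^4, or a point of period 2,
    c = -1 - s^2 - s^4 ([square_periodic_param]).

    A preperiodic integer e satisfies e^2 + c <= |e|, since otherwise its orbit
    increases to infinity ([preperiodic_small]).  For the two values of c above
    this says roughly |e| <= s^2 + 1 ([preperiodic_bound]).

    Now let s and t be the parameters of two such maps, of constants c and c',
    with t < s.  If b^2 + c is preperiodic for x^2 + c', then b^2 = e - c with e
    of size at most about t^2 + 1, while -c is s^4 - s^2 or s^4 + s^2 + 1.  Hence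
    b^2 lies strictly between two consecutive squares, unless s = 1 and t = 0
    ([larger_param_no_meet]).  So either the parameters agree, and as the
    constants differ one map is of each kind, which is the infinite family; or
    the parameters are 1 and 0, which leaves (-1, -3) and the members (0, -1) and
    (0, -3) of the family. *)

Set Implicit Arguments.
Unset Strict Implicit.
Unset Printing Implicit Defensive.

Import GRing.Theory Order.TTheory Num.Theory.
Local Open Scope ring_scope.
Local Open Scope classical_set_scope.

(** * Iteration of x^2 + c *)

Definition quad_map (R : pzRingType) (c x : R) : R := x ^+ 2 + c.
Arguments quad_map {R}.

(** The two constants [c] for which [s ^+ 2] is fixed by [x ^+ 2 + c],
    respectively lies on a cycle of length 2, whose points have sum -1. *)
Definition square_param (c s : int) : Prop :=
  c = s ^+ 2 - s ^+ 4 \/ c = - 1 - s ^+ 2 - s ^+ 4.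

Lemma horner_iter_quad (c : int) n (P : rat) :
  (iter_poly (quad c) n).[P] = iter n (quad_map c%:~R) P.
Proof.
elim: n => [|n IHn]; first by rewrite /= hornerX.
by rewrite /iter_poly iterS horner_comp -/(iter_poly _ n) IHn /quad !hornerE.
Qed.

Lemma iter_quad_map_intr (c x : int) n :
  iter n (quad_map c%:~R) (x%:~R : rat) = (iter n (quad_map c) x)%:~R.
Proof. by elim: n => //= n ->; rewrite /quad_map rmorphD rmorphXn. Qed.

(** * Integrality of periodic points *)

(** If [x = p / q] in lowest terms, then [p ^+ 2 + c * q ^+ 2] is still coprime
    to [q ^+ 2], so no cancellation occurs. *)
Lemma denq_sqr_add_int (x : rat) (c : int) :
  denq (quad_map c%:~R x) = denq x ^+ 2.
Proof.
have den0 : (denq x)%:~R != 0 :> rat by rewrite intr_eq0 denq_neq0.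
have -> : quad_map c%:~R x
        = (numq x ^+ 2 + c * denq x ^+ 2)%:~R / (denq x ^+ 2)%:~R.
  rewrite /quad_map -{1}[x]divq_num_den rmorphD rmorphM !rmorphXn /=.
  by field.
rewrite coprimeq_den.
  by rewrite sqrf_eq0 denq_eq0 ger0_norm // sqr_ge0.
have : coprimez (numq x ^+ 2) (denq x ^+ 2).
  by rewrite coprimezXl ?coprimezXr // /coprimez; apply: coprime_num_den.
by rewrite -coprimezE /coprimez addrC ![gcdz _ (denq x ^+ 2)]gcdzC gcdzMDl.
Qed.

Lemma periodic_denq1 (c : int) (x : rat) n : (0 < n)%N ->
  iter n (quad_map c%:~R) x = x -> denq x = 1.
Proof.
move=> n_gt0 per_x.
have den_iter k : denq (iter k (quad_map c%:~R) x) = denq x ^+ (2 ^ k).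
  by elim: k => [//|k IHk]; rewrite iterS denq_sqr_add_int IHk -exprM expnSr.
have /eqP := den_iter n; rewrite per_x -{1}[denq x]expr1.
have [->//|den_neq1] := eqVneq (denq x) 1.
have den_gt1 : 1 < denq x by have := denq_gt0 x; lia.
by rewrite lt_eqF // ltr_eXn2l // -[X in (X < _)%N](expn0 2) ltn_exp2l.
Qed.

(** * Integer cycles *)

(** Consecutive differences of an orbit: the next one is a multiple of the
    current one, with the sum of the two points as the quotient. *)
Lemma quad_map_diff (c y : int) :
  quad_map c (quad_map c y) - quad_map c y
  = (quad_map c y - y) * (quad_map c y + y).
Proof. by rewrite /quad_map; ring. Qed.

Lemma dvd_diff_iter (c y : int) k :
  (quad_map c y - y
     %| quad_map c (iter k (quad_map c) y) - iter k (quad_map c) y)%Z.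
Proof.
elim: k => [|k IHk]; first exact: dvdzz.
by rewrite iterS quad_map_diff dvdz_mulr.
Qed.

(** Going once around the cycle, the difference at [y] is a multiple of itself
    times the sum [quad_map c y + y] and other factors, so this sum is a unit. *)
Lemma cycle_sum_unit (c y : int) n : (0 < n)%N ->
  iter n (quad_map c) y = y -> quad_map c y != y ->
  quad_map c y + y = 1 \/ quad_map c y + y = - 1.
Proof.
case: n => // n _ per_y nfix_y.
have := dvd_diff_iter c (quad_map c y) n.
rewrite -iterSr per_y quad_map_diff -[X in (_ %| X)%Z]mulr1.
rewrite dvdz_mul2l; last by rewrite subr_eq0.
rewrite dvdz1; lia.
Qed.

(** If all consecutive sums are 1, the orbit is an arithmetic progression, and
    being periodic it is constant.  Otherwise some sum is -1, which closes up a
    cycle of length 2. *)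
Lemma int_cycle_length_le2 (c x : int) n : (0 < n)%N ->
  iter n (quad_map c) x = x ->
  quad_map c x = x \/ quad_map c x = - 1 - x.
Proof.
move=> n_gt0 per_x; set f := quad_map c.
have [fix_x|nfix_x] := eqVneq (f x) x; first by left.
right.
have per_iter i : iter n f (iter i f x) = iter i f x.
  by rewrite -iterD addnC iterD per_x.
(* A point of the orbit leads back to [x], so a period of that point is also a
   period of [x]. *)
have back (m i : nat) : (i <= n)%N -> iter m f (iter i f x) = iter i f x ->
    iter m f x = x.
  move=> le_in eq_i.
  have xE : iter (n - i) f (iter i f x) = x by rewrite -iterD subnK.
  by rewrite -[in LHS]xE -iterD addnC iterD eq_i.
have [/forallP all1|] := boolP [forall i : 'I_n, f (iter i f x) + iter i f x == 1].
  have arith k : (k <= n)%N ->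
      iter k f x = x + (f x - x) * k%:R /\
      ((k < n)%N -> f (iter k f x) - iter k f x = f x - x).
    elim: k => [|k IHk] lt_kn; first by rewrite /= mulr0 addr0.
    have [IH1 /(_ lt_kn) IH2] := IHk (ltnW lt_kn).
    have itSE : iter k.+1 f x = x + (f x - x) * k.+1%:R.
      by rewrite iterS -[f (iter k f x)](subrK (iter k f x)) IH2 IH1 mulrS; ring.
    split=> // lt_Skn.
    have /eqP sum1 := all1 (Ordinal lt_kn).
    by rewrite iterS quad_map_diff -/f sum1 mulr1.
  have [] := arith n (leqnn n); rewrite per_x => /eqP.
  rewrite -{1}[x]addr0 (inj_eq (addrI x)) eq_sym mulf_eq0 subr_eq0.
  by rewrite (negPf nfix_x) pnatr_eq0 eqn0Ngt n_gt0.
rewrite negb_forall => /existsP [[i lt_in] /= sum_neq1].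
have nfix_i : f (iter i f x) != iter i f x.
  apply: contra nfix_x => /eqP fix_i; apply/eqP.
  exact: (back 1%N i (ltnW lt_in)).
have [sum1|sumN1] := cycle_sum_unit n_gt0 (per_iter i) nfix_i.
  by rewrite sum1 eqxx in sum_neq1.
have per2_i : iter 2 f (iter i f x) = iter i f x.
  apply/eqP; rewrite /= -subr_eq0.
  rewrite -[f (f _)](subrK (f (iter i f x))) quad_map_diff sumN1.
  by apply/eqP; ring.
have per2 : f (f x) = x := back 2%N i (ltnW lt_in) per2_i.
have /eqP : (f x - x) * (1 + (f x + x)) = 0.
  by rewrite mulrDr mulr1 -quad_map_diff -/f per2; ring.
rewrite mulf_eq0 subr_eq0 (negPf nfix_x) /= => /eqP.
lia.
Qed.

Lemma square_periodic_param (c : int) :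
  Per (quad c) `&` rational_squares !=set0 ->
  exists2 s : int, 0 <= s & square_param c s.
Proof.
move=> [P [[n [n_gt0 per_r]] [r _ rE]]]; subst P.
rewrite horner_iter_quad in per_r.
have den_r : denq r = 1.
  have := periodic_denq1 n_gt0 per_r.
  have := denq_sqr_add_int r 0; rewrite /quad_map addr0 => -> /eqP.
  by rewrite sqrp_eq1 ?denq_ge0 // => /eqP.
have rE : r = (numq r)%:~R by rewrite -{1}[r]divq_num_den den_r divr1.
move: (numq r) rE => z rE; subst r => {den_r}.
exists `|z|; first exact: normr_ge0.
move: per_r; rewrite -rmorphXn iter_quad_map_intr => /intr_inj per_s.
have s4E : `|z| ^+ 4 = (z ^+ 2) ^+ 2.
  by rewrite -[4%N]/(2 * 2)%N exprM real_normK ?num_real.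
have := int_cycle_length_le2 n_gt0 per_s.
rewrite /square_param s4E real_normK ?num_real // /quad_map.
by lia.
Qed.

(** * Preperiodic integers are small *)

Lemma escaping_iter (c x : int) n : `|x| < quad_map c x ->
  let y := iter n (quad_map c) x in
  `|y| < quad_map c y /\ ((0 < n)%N -> `|x| < y).
Proof.
move=> esc_x /=; elim: n => [//|n [IH1 IH2]]; rewrite iterS.
set y := iter n _ x in IH1 IH2 *.
have x_lt : `|x| < quad_map c y.
  move: IH1 IH2; rewrite /y; case: (n) => [//|k] IH1 /(_ isT); lia.
split=> //; have zE : quad_map c y = `|y| ^+ 2 + c by rewrite real_normK ?num_real.
move: (quad_map c y) zE IH1 => z zE lt_yz; rewrite /quad_map.
have := normr_ge0 y; nia.
Qed.

(** An integer with [`|x| < x ^+ 2 + c] keeps this property under iteration, so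
    that its orbit is strictly increasing after the first step and never
    reaches a periodic point. *)
Lemma preperiodic_small (c x : int) :
  PrePer (quad c) x%:~R -> quad_map c x <= `|x|.
Proof.
move=> [n [_ [m [m_gt0]]]]; rewrite !horner_iter_quad !iter_quad_map_intr.
move=> /intr_inj per_y; rewrite leNgt; apply/negP => /(escaping_iter n) [esc_y _].
have [_ /(_ m_gt0)] := escaping_iter m esc_y.
by rewrite per_y ltNge ler_norm.
Qed.

Lemma meet_small (c c' : int) :
  int_image (quad c) `&` PrePer (quad c') !=set0 ->
  exists b : int, quad_map c' (quad_map c b) <= `|quad_map c b|.
Proof.
move=> [_ [[b _ <-] pre_b]]; exists b; apply: preperiodic_small.
by move: pre_b; rewrite /quad !hornerE /quad_map rmorphD rmorphXn.
Qed.

(** If [`|e|] is at least [t ^+ 2 + 2], then [`|e| ^+ 2 - `|e|] is at least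
    [(t ^+ 2 + 2) * (t ^+ 2 + 1)], which exceeds both [t ^+ 4 - t ^+ 2] and
    [t ^+ 4 + t ^+ 2 + 1], the two possible values of [- c]. *)
Lemma preperiodic_bound (c t e : int) : square_param c t ->
  quad_map c e <= `|e| -> `|e| <= t ^+ 2 + 1.
Proof.
rewrite /square_param -[4%N]/(2 * 2)%N exprM /quad_map -(real_normK (num_real e)).
have := normr_ge0 e; have := sqr_ge0 t.
move: (t ^+ 2) `|e| => T E; nia.
Qed.

(** * Squares between consecutive squares *)

Lemma no_square_between (a b : int) : 0 <= a ->
  a ^+ 2 < b ^+ 2 -> b ^+ 2 < (a + 1) ^+ 2 -> False.
Proof.
move=> a_ge0; rewrite -(real_normK (num_real b)).
rewrite !ltr_sqr ?nnegrE ?normr_ge0 ?addr_ge0 // => lt_ab lt_ba.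
lia.
Qed.

(** With [e := b ^+ 2 + c], the square [b ^+ 2] is [s ^+ 4 - s ^+ 2 + e] or
    [s ^+ 4 + s ^+ 2 + 1 + e], where [`|e| <= (s - 1) ^+ 2 + 1 < s ^+ 2 - 1] when
    [1 < s]: this is strictly between the squares of [s ^+ 2 - 1] and [s ^+ 2],
    respectively of [s ^+ 2] and [s ^+ 2 + 1]. *)
Lemma larger_param_no_meet (c c' s t b : int) : 0 <= t -> t < s ->
  square_param c s -> square_param c' t ->
  quad_map c' (quad_map c b) <= `|quad_map c b| -> s = 1 /\ t = 0.
Proof.
move=> t_ge0 lt_ts cE c'E /(preperiodic_bound c'E) e_le.
have [s_le1|s_gt1] := leP s 1; first by lia.
exfalso; have eE : quad_map c b = b ^+ 2 + c by [].
have e_lt : `|quad_map c b| < s ^+ 2 - 1.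
  by apply: le_lt_trans e_le _; nia.
have sqs_gt0 : 0 < s ^+ 2 by nia.
move: cE; rewrite /square_param -[4%N]/(2 * 2)%N exprM => cE.
move: (quad_map c b) eE e_lt => e eE e_lt {e_le}.
move: (s ^+ 2) sqs_gt0 e_lt cE => S S_gt0 e_lt [] cE.
  by apply: (@no_square_between (S - 1) b); nia.
by apply: (@no_square_between S b); nia.
Qed.

Theorem theorem1p2 (c1 c2 : int) (c1_neq_c2 : c1 <> c2)
  (sq_per1 : Per (quad c1) `&` rational_squares !=set0)
  (sq_per2 : Per (quad c2) `&` rational_squares !=set0)
  (meet12 : int_image (quad c1) `&` PrePer (quad c2) !=set0)
  (meet21 : int_image (quad c2) `&` PrePer (quad c1) !=set0) :
  exists d1 d2 : int,
    ((d1, d2) = (c1, c2) \/ (d1, d2) = (c2, c1)) /\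
    ((d1, d2) = (- 1, - 3) \/
     exists s : int, (d1, d2) = (s ^+ 2 - s ^+ 4, - 1 - s ^+ 2 - s ^+ 4)).
Proof.
have [s s_ge0 c1E] := square_periodic_param sq_per1.
have [t t_ge0 c2E] := square_periodic_param sq_per2.
have [b1 small1] := meet_small meet12; have [b2 small2] := meet_small meet21.
have [lt_ts|lt_st|eq_ts] := ltgtP t s.
- have [s1 t0] := larger_param_no_meet t_ge0 lt_ts c1E c2E small1.
  subst s t; case: c1E c2E c1_neq_c2 => -> [] -> // _.
  + by exists 0, (- 1); split; [left | right; exists 0].
  + by exists 0, (- 3); split; [right | right; exists 1].
  + by exists (- 1), (- 3); split; [right | left].
- have [t1 s0] := larger_param_no_meet s_ge0 lt_st c2E c1E small2.
  subst s t; case: c1E c2E c1_neq_c2 => -> [] -> // _.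
  + by exists 0, (- 3); split; [left | right; exists 1].
  + by exists 0, (- 1); split; [right | right; exists 0].
  + by exists (- 1), (- 3); split; [left | left].
- subst t; case: c1E c2E c1_neq_c2 => -> [] -> // _.
  + by exists (s ^+ 2 - s ^+ 4), (- 1 - s ^+ 2 - s ^+ 4); split; [left | right; exists s].
  + by exists (s ^+ 2 - s ^+ 4), (- 1 - s ^+ 2 - s ^+ 4); split; [right | right; exists s].
Qed.
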